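(* Let $(k_n)$ be a subsequence of $\mathbb{N}$. (a) Suppose there exists a continuous complex Borel measure $\mu$ on $\mathbb{T}$ with $$\limsup_{N\to\infty}\frac1N\sum_{n=1}^N|\widehat\mu(k_n)|^2>0.$$ Then either $(k_n)$ is not good, or $(k_n)$ is good with uncountable spectrum. (b) If $(k_n)$ is a $\theta$-rigidity sequence for some $\theta\in\mathbb{T}$, then $(k_n)$ is not good.
   Context: $\mathbb{T}$ is the unit circle in $\mathbb{C}$, $\mathbb{N}=\{1,2,\dots\}$; a subsequence $(k_n)$ of $\mathbb{N}$ is a function $k:\mathbb{N}\to\mathbb{N}$ that is strictly increasing for sufficiently large indices. For a complex Borel measure $\mu$ on $\mathbb{T}$, $\widehat\mu(k)=\int_{\mathbb{T}}z^k\,\mathrm{d}\mu(z)$; $\mu$ is continuous if it has no atoms, i.e. $\mu(\{a\})=0$ for all $a\in\mathbb{T}$. The sequence $(k_n)$ is good if $c(\lambda):=\lim_{N\to\infty}\frac1N\sum_{n=1}^N\lambda^{k_n}$ exists for every $\lambda\in\mathbb{T}$; its spectrum is then $\{\lambda\in\mathbb{T}:c(\lambda)\ne0\}$. For $\theta\in\mathbb{T}$, $(k_n)$ is a $\theta$-rigidity sequence if there is a continuous Borel probability measure $\mu$ on $\mathbb{T}$ with $\widehat\mu(k_n)\to\theta$ as $n\to\infty$. *)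

(* Defs.v *)
From HB Require Import structures.
From mathcomp Require Import all_boot all_order all_algebra.
From mathcomp Require Import all_classical all_reals all_analysis.
From mathcomp Require Import complex.

Set Implicit Arguments.
Unset Strict Implicit.
Unset Printing Implicit Defensive.

Import Order.TTheory GRing.Theory Num.Theory.
Import numFieldNormedType.Exports.

Local Open Scope classical_set_scope.
Local Open Scope ring_scope.
Local Open Scope complex_scope.
Local Open Scope measure_display_scope.

(* complex.v puts no topology on R[i]; take the one of its norm `|_|. *)
HB.instance Definition _ (R : realType) :=
  PseudoMetricNormedZmod.copy R[i] R[i]^o.

Section complex_limits.
Variable R : realType.

Lemma normcE (z : R[i]) : `|z| = (Normc.normc z)%:C.
Proof. by []. Qed.

Lemma abs_Re_le_normc (z : R[i]) : `|complex.Re z| <= Normc.normc z.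
Proof.
case: z => a b; rewrite /= -sqrtr_sqr ler_sqrt ?lerDl ?addr_ge0 ?sqr_ge0//.
Qed.

Lemma abs_Im_le_normc (z : R[i]) : `|complex.Im z| <= Normc.normc z.
Proof.
case: z => a b; rewrite /= -sqrtr_sqr ler_sqrt ?lerDr ?addr_ge0 ?sqr_ge0//.
Qed.

Lemma cvgC_Re (u : nat -> R[i]) (l : R[i]) :
  u @ \oo --> l -> complex.Re (u n) @[n --> \oo] --> complex.Re l.
Proof.
move=> /cvgrPdist_lt ul; apply/cvgrPdist_lt => e e0.
have e0C : 0 < e%:C :> R[i] by rewrite ltcR.
have := ul _ e0C; apply: filterS => n.
rewrite normcE ltcR; apply: le_lt_trans.
by rewrite -raddfB; exact: abs_Re_le_normc.
Qed.

Lemma cvgC_Im (u : nat -> R[i]) (l : R[i]) :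
  u @ \oo --> l -> complex.Im (u n) @[n --> \oo] --> complex.Im l.
Proof.
move=> /cvgrPdist_lt ul; apply/cvgrPdist_lt => e e0.
have e0C : 0 < e%:C :> R[i] by rewrite ltcR.
have := ul _ e0C; apply: filterS => n.
rewrite normcE ltcR; apply: le_lt_trans.
by rewrite -raddfB; exact: abs_Im_le_normc.
Qed.

Lemma cvgC_real (u : nat -> R) (l : R) :
  u @ \oo --> l -> (u n)%:C @[n --> \oo] --> (l%:C : R[i]).
Proof.
move=> /cvgrPdist_lt ul; apply/cvgrPdist_lt => -[e f].
rewrite ltcE /= => /andP[/eqP -> e0].
have := ul _ e0; apply: filterS => n.
rewrite normcE -raddfB /= expr0n addr0 sqrtr_sqr.
by rewrite ltcR.
Qed.

End complex_limits.

Section circle.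
Variable R : realType.

Definition unit_circle : set R[i] := [set z | `|z| = 1].

Definition circle : Type := set_type unit_circle.

HB.instance Definition _ := Choice.on circle.
HB.instance Definition _ := Topological.on circle.

Definition circle_val (z : circle) : R[i] := set_val z.

Lemma circle1_subproof : (1 : R[i]) \in unit_circle.
Proof. by rewrite inE /unit_circle /= normr1. Qed.

HB.instance Definition _ := isPointed.Build circle (SigSub circle1_subproof).

Definition borel_circle : Type := g_sigma_algebraType (@open circle).

HB.instance Definition _ := Measurable.on borel_circle.

End circle.

Coercion circle_val : circle >-> complex.

Section complex_measure.
Context d (T : measurableType d) (R : realType).

Record complex_measure := ComplexMeasure {
  cmeasure :> set T -> R[i] ;
  cmeasure_sigma_additive : forall F : (set T)^nat,
    (forall n, measurable (F n)) -> trivIset setT F ->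
    (fun n => \sum_(0 <= i < n) cmeasure (F i)) @ \oo
      --> cmeasure (\bigcup_n F n) }.

Lemma cmeasure0 (mu : complex_measure) : mu set0 = 0.
Proof.
have mu0 := @cmeasure_sigma_additive mu (fun=> set0) (fun=> measurable0)
  (@trivIset_set0 _ _ _).
rewrite bigcup0// in mu0.
have mu1 : (fun n => \sum_(0 <= i < n.+1) mu set0) @ \oo --> mu set0.
  by rewrite -cvg_shiftS in mu0.
have mu_lim : (fun=> mu set0) @ \oo --> mu set0 - mu set0.
  rewrite (_ : (fun=> _) = (fun n => \sum_(0 <= i < n.+1) mu set0) -
      (fun n => \sum_(0 <= i < n) mu set0)); first exact: cvgB.
  by apply/funext => n; rewrite !fctE big_nat_recr//= addrC addKr.
have H : hausdorff_space R[i] by exact: norm_hausdorff.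
by rewrite -(subrr (mu set0)) -(cvg_lim H mu_lim) lim_cst.
Qed.

Section parts.
Variable mu : complex_measure.

Definition cmeasure_Re (A : set T) : \bar R := (complex.Re (mu A))%:E.
Definition cmeasure_Im (A : set T) : \bar R := (complex.Im (mu A))%:E.

Let cmeasure_Re0 : cmeasure_Re set0 = 0%E.
Proof. by rewrite /cmeasure_Re cmeasure0. Qed.

Let cmeasure_Re_fin A : measurable A -> cmeasure_Re A \is a fin_num.
Proof. by []. Qed.

Let cmeasure_Re_sigma_additive : semi_sigma_additive cmeasure_Re.
Proof.
move=> F mF tF _; apply/fine_cvgP; split.
  by apply: nearW => n; rewrite sumEFin.
have := cvgC_Re (@cmeasure_sigma_additive mu _ mF tF); apply: cvg_trans.
apply: near_eq_cvg; apply: nearW => n /=.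
by rewrite sumEFin raddf_sum.
Qed.

HB.instance Definition _ := isCharge.Build _ T R cmeasure_Re
  cmeasure_Re0 cmeasure_Re_fin cmeasure_Re_sigma_additive.

Let cmeasure_Im0 : cmeasure_Im set0 = 0%E.
Proof. by rewrite /cmeasure_Im cmeasure0. Qed.

Let cmeasure_Im_fin A : measurable A -> cmeasure_Im A \is a fin_num.
Proof. by []. Qed.

Let cmeasure_Im_sigma_additive : semi_sigma_additive cmeasure_Im.
Proof.
move=> F mF tF _; apply/fine_cvgP; split.
  by apply: nearW => n; rewrite sumEFin.
have := cvgC_Im (@cmeasure_sigma_additive mu _ mF tF); apply: cvg_trans.
apply: near_eq_cvg; apply: nearW => n /=.
by rewrite sumEFin raddf_sum.
Qed.

HB.instance Definition _ := isCharge.Build _ T R cmeasure_Im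
  cmeasure_Im0 cmeasure_Im_fin cmeasure_Im_sigma_additive.

End parts.

(* Real-valued integrands against a charge, through its Jordan decomposition;
   the measures do not depend on the chosen Hahn decomposition
   (Hahn_decomposition_uniq). *)
Definition charge_integral (nu : {charge set T -> \bar R}) (f : T -> R) : R :=
  let hahnP := cid (Hahn_decomposition nu) in
  let hahnN := cid (projT2 hahnP) in
  \int[jordan_pos (projT2 hahnN)]_x f x
  - \int[jordan_neg (projT2 hahnN)]_x f x.

(* The integral of f = u + iv against mu = mu1 + i mu2. *)
Definition cmeasure_integral (mu : complex_measure) (f : T -> R[i]) : R[i] :=
  let u x := complex.Re (f x) in
  let v x := complex.Im (f x) in
  (charge_integral (cmeasure_Re mu) u - charge_integral (cmeasure_Im mu) v)
  +i* (charge_integral (cmeasure_Re mu) v + charge_integral (cmeasure_Im mu) u).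

Section of_finite_measure.
Variable m : {finite_measure set T -> \bar R}.

Let cmeasure_of_sigma_additive (F : (set T)^nat) :
  (forall n, measurable (F n)) -> trivIset setT F ->
  (fun n => \sum_(0 <= i < n) (fine (m (F i)))%:C) @ \oo
    --> ((fine (m (\bigcup_n F n)))%:C : R[i]).
Proof.
move=> mF tF.
have mUF : measurable (\bigcup_n F n) by exact: bigcup_measurable.
have mcvg : (fun n => \sum_(0 <= i < n) m (F i))%E @ \oo
    --> (fine (m (\bigcup_n F n)))%:E.
  rewrite fineK ?fin_num_measure//; exact: measure_semi_sigma_additive.
have /fine_cvgP[_ /cvgC_real] := mcvg.
apply: cvg_trans; apply: near_eq_cvg; apply: nearW => n /=.
rewrite -raddf_sum; congr (_%:C).
by rewrite -sum_fine// => i _; rewrite fin_num_measure.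
Qed.

Definition cmeasure_of : complex_measure :=
  @ComplexMeasure (fun A => (fine (m A))%:C) cmeasure_of_sigma_additive.

End of_finite_measure.

End complex_measure.

Section subsequences.
Variable R : realType.
Implicit Types (k : nat -> nat) (z : circle R).

(* Sequences are indexed by positive integers: the value k 0 is irrelevant. *)
Definition subsequence k :=
  (forall n, (0 < n)%N -> (0 < k n)%N) /\
  exists n0 : nat, forall m n : nat, (n0 <= m)%N -> (m < n)%N -> (k m < k n)%N.

Definition fourier_coef (mu : complex_measure (borel_circle R) R) (j : int) : R[i] :=
  cmeasure_integral mu (fun z : circle R => (z : R[i]) ^ j).

Definition continuous_cmeasure (mu : complex_measure (borel_circle R) R) :=
  forall a : circle R, mu [set a] = 0.

Definition cesaro_mean k z (N : nat) : R[i] :=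
  N%:R^-1 * \sum_(1 <= n < N.+1) (z : R[i]) ^+ k n.

Definition good k := forall z, cvgn (cesaro_mean k z).

Definition good_limit k z : R[i] := limn (cesaro_mean k z).

(* Meaningful only when k is good. *)
Definition spectrum k : set (circle R) := [set z | good_limit k z != 0].

Definition rigidity_sequence (theta : circle R) k :=
  exists P : probability (borel_circle R) R,
    continuous_cmeasure (cmeasure_of P) /\
    fourier_coef (cmeasure_of P) (k n) @[n --> \oo] --> (theta : R[i]).

End subsequences.

Arguments good_limit : clear implicits.
Arguments spectrum : clear implicits.

(* Main.v *)
(** (a) Assume [k] is good with countable spectrum.  For a continuous complex
    measure [mu] put [g_N z = 1/N sum_{n<=N} conj(mu^(k_n)) z^{k_n}], which is
    the conjugate of the integral of the Cesaro mean at [w/z] against [dmu w].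
    That mean tends to [0] off a translate of the spectrum, a null set, so
    [g_N -> 0] pointwise by dominated convergence; integrating once more,
    [1/N sum |mu^(k_n)|^2 = int g_N dmu -> 0].

    (b) Let [P^(k_n) -> theta] with [k] good.  The integral of
    [1/N sum |z^{k_n} - theta|^2] tends to [0], hence so does the integrand for
    [P]-almost every [z].  As [P] has no atoms, two such points have a quotient
    [h] of infinite order, and [D_N(z) = 1/N sum (1 - Re z^{k_n})] tends to [0]
    at every power of [h].  As [k] is good, [D_N] converges everywhere, so by Baire's
    theorem there is an arc such that, for all large [N], [D_N <= 1/4] at all
    the powers of [h] it contains.  Average [F D_N] over the powers of [h], with [F] the Fejer
    kernel of order [L] (times [L]) centred in the arc.  The average is at most
    [L/4 + O(1)] as [F] is bounded off the arc; but by orthogonality the terms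
    with [k_n >= L] contribute [L] each before dividing by [N], so it is also
    at least [L (1 - o(1))] as [N] grows: contradiction for large [L]. *)
Require Import Defs.
From mathcomp Require Import all_boot all_order all_algebra.
From mathcomp Require Import all_classical all_reals all_analysis.
From mathcomp Require Import complex.
From mathcomp Require Import measurable_realfun zify ring lra.
Import Order.TTheory GRing.Theory Num.Theory.
Import numFieldNormedType.Exports.
Local Open Scope classical_set_scope.
Local Open Scope ring_scope.

Set Implicit Arguments.
Unset Strict Implicit.
Unset Printing Implicit Defensive.

(** * Complex numbers of modulus one *)

Section complex_numbers.
Variable R : realType.
Local Open Scope complex_scope.
Local Notation normc := (@Normc.normc R).
Local Notation Re := (@complex.Re R).
Local Notation Im := (@complex.Im R).
Implicit Types (z w : R[i]).

Lemma normc_sqr z : normc z ^+ 2 = Re z ^+ 2 + Im z ^+ 2.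
Proof. by case: z => a b /=; rewrite sqr_sqrtr// addr_ge0 ?sqr_ge0. Qed.

Lemma normc_ge0 z : 0 <= normc z.
Proof. by case: z => a b; exact: sqrtr_ge0. Qed.

Lemma normcX z n : normc (z ^+ n) = normc z ^+ n.
Proof.
by elim: n => [|n IH]; rewrite ?expr0 ?Normc.normc1// !exprS Normc.normcM IH.
Qed.

Lemma normc_real (x : R) : normc x%:C = `|x|.
Proof. by rewrite /= expr0n addr0 sqrtr_sqr. Qed.

Lemma normc_sum (I : Type) (s : seq I) (P : pred I) (f : I -> R[i]) :
  normc (\sum_(i <- s | P i) f i) <= \sum_(i <- s | P i) normc (f i).
Proof.
elim/big_ind2 : _ => [|x y z t hx hz|//]; first by rewrite Normc.normc0.
by rewrite (le_trans (le_normcD _ _))// lerD.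
Qed.

Lemma normc_sqrC z : (normc z ^+ 2)%:C = z * z^*.
Proof.
rewrite normc_sqr; case: z => a b; apply/eqP; rewrite eq_complex/=.
by apply/andP; split; apply/eqP; ring.
Qed.

Lemma ReM (z w : R[i]) : Re (z * w) = Re z * Re w - Im z * Im w.
Proof. by case: z w => ? ? []. Qed.

Lemma ImM (z w : R[i]) : Im (z * w) = Re z * Im w + Im z * Re w.
Proof. by case: z w => ? ? []. Qed.

Lemma ReD (z w : R[i]) : Re (z + w) = Re z + Re w.
Proof. by case: z w => ? ? []. Qed.

Lemma ImD (z w : R[i]) : Im (z + w) = Im z + Im w.
Proof. by case: z w => ? ? []. Qed.

Lemma natrVC N : (N%:R^-1 : R[i]) = (N%:R^-1 : R)%:C.
Proof. by rewrite fmorphV rmorph_nat. Qed.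

Lemma real_complexM (a b : R) : (a * b)%:C = a%:C * b%:C.
Proof. exact: (rmorphM (real_complex R)). Qed.

Lemma normc_conjc (z : R[i]) : normc (conjc z) = normc z.
Proof. by case: z => a b; rewrite /= sqrrN. Qed.

Lemma Re_realM (a : R) (z : R[i]) : Re (a%:C * z) = a * Re z.
Proof. by case: z => b c /=; rewrite mul0r subr0. Qed.

Lemma Im_realM (a : R) (z : R[i]) : Im (a%:C * z) = a * Im z.
Proof. by case: z => b c /=; rewrite mul0r addr0. Qed.

Lemma Im_sum (I : Type) (s : seq I) (f : I -> R[i]) :
  Im (\sum_(i <- s) f i) = \sum_(i <- s) Im (f i).
Proof. by elim/big_ind2 : _ => // x y z t <- <-; rewrite ImD. Qed.

Lemma Re_sum (I : Type) (s : seq I) (f : I -> R[i]) :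
  Re (\sum_(i <- s) f i) = \sum_(i <- s) Re (f i).
Proof. by elim/big_ind2 : _ => // x y z t <- <-; rewrite ReD. Qed.

Lemma sum_real_complex (I : Type) (s : seq I) (P : pred I) (f : I -> R) :
  \sum_(i <- s | P i) (f i)%:C = (\sum_(i <- s | P i) f i)%:C.
Proof. exact/esym/(raddf_sum (real_complex R)). Qed.

Lemma normc_le_ReIm (z : R[i]) : normc z <= `|Re z| + `|Im z|.
Proof.
rewrite -(ler_pXn2r (n := 2)) ?nnegrE ?normc_ge0 ?addr_ge0// normc_sqr.
rewrite -[Re z ^+ 2]real_normK ?num_real// -[Im z ^+ 2]real_normK ?num_real//.
by rewrite sqrrD lerD2r lerDl mulrn_wge0// mulr_ge0.
Qed.

Lemma unimodular_neq0 z : normc z = 1 -> z != 0.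
Proof.
by move=> z1; apply/eqP => z0; move/eqP: z1; rewrite z0 Normc.normc0 eq_sym oner_eq0.
Qed.

Lemma unimodular_conjc z : normc z = 1 -> z^* = z^-1.
Proof.
move=> z1; have z0 := unimodular_neq0 z1; apply: (mulfI z0).
by rewrite mulfV// -normc_sqrC z1 expr1n.
Qed.

Lemma unimodularX z n : normc z = 1 -> normc (z ^+ n) = 1.
Proof. by move=> z1; rewrite normcX z1 expr1n. Qed.

Lemma unimodularV z : normc z = 1 -> normc z^-1 = 1.
Proof. by move=> z1; rewrite Normc.normcV z1 invr1. Qed.

Lemma unimodularM z w : normc z = 1 -> normc w = 1 -> normc (z * w) = 1.
Proof. by move=> z1 w1; rewrite Normc.normcM z1 w1 mulr1. Qed.

Lemma unimodular_Re z : normc z = 1 -> -1 <= Re z <= 1.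
Proof. by move=> z1; rewrite -ler_norml -z1 abs_Re_le_normc. Qed.

(** Multiplication by [w - 1] telescopes the sum to [w ^+ n - 1]; the product form also covers
    [w = 1]. *)
Lemma geometric_sum_bound w n : normc w = 1 ->
  normc (\sum_(i < n) w ^+ i) * normc (w - 1) <= 2.
Proof.
move=> w1; rewrite mulrC -Normc.normcM -subrX1.
rewrite (le_trans (le_normcD _ _))// normcN Normc.normc1 unimodularX//; lra.
Qed.

End complex_numbers.

(** * Rational parametrisation of the punctured circle *)

Section cayley.
Variable R : realType.
Local Open Scope complex_scope.
Local Notation normc := (@Normc.normc R).
Local Notation Re := (@complex.Re R).
Local Notation Im := (@complex.Im R).

(* [cayley t = (1 + it) / (1 - it)]: stereographic chart of the circle minus -1. *)
Definition cayley (t : R) : R[i] :=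
  ((1 - t ^+ 2) / (1 + t ^+ 2)) +i* ((2 * t) / (1 + t ^+ 2)).

Let den_gt0 (t : R) : 0 < 1 + t ^+ 2.
Proof. by rewrite ltr_pwDl// sqr_ge0. Qed.

Let den_neq0 (t : R) : 1 + t ^+ 2 != 0.
Proof. by rewrite gt_eqF. Qed.

Lemma normc_cayley t : normc (cayley t) = 1.
Proof.
apply/eqP; rewrite -(eqrXn2 (n := 2%N))// ?normc_ge0// normc_sqr/= expr1n.
by apply/eqP; field.
Qed.

Lemma cayley_surj z : normc z = 1 -> z != -1 -> exists t, z = cayley t.
Proof.
move=> z1 zN1; have := normc_sqr z; rewrite z1 expr1n.
case: z z1 zN1 => a b z1 zN1 /= ab.
have a1 : 1 + a != 0.
  apply: contra zN1 => /eqP a1; have aE : a = -1 by lra.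
  have b0 : b ^+ 2 = 0 by move: ab; rewrite aE sqrrN expr1n => ?; lra.
  rewrite aE eq_complex/= eqxx/= oppr0; move/eqP: b0.
  by rewrite sqrf_eq0.
(* The slope of the chord from -1 to [z], that is, the tangent of half the argument. *)
exists (b / (1 + a)).
have bE : b ^+ 2 = (1 - a) * (1 + a) by rewrite mulrC; lra.
have tE : (b / (1 + a)) ^+ 2 = (1 - a) / (1 + a).
  by rewrite expr_div_n bE; field.
rewrite /cayley tE; apply/eqP; rewrite eq_complex/=.
have e1 : 1 + (1 - a) / (1 + a) = 2 / (1 + a) by field.
have e2 : 1 - (1 - a) / (1 + a) = 2 * a / (1 + a) by field.
by rewrite e1 e2; apply/andP; split; apply/eqP; field; rewrite a1.
Qed.

Lemma normc_cayleyB s t : normc (cayley s - cayley t) ^+ 2 =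
  4 * (s - t) ^+ 2 / ((1 + s ^+ 2) * (1 + t ^+ 2)).
Proof. by rewrite normc_sqr/=; field; rewrite !den_neq0. Qed.

(** Leaving an interval of parameters means leaving an arc: for large [s] the point [cayley s] only
    approaches -1, at positive distance from [cayley t]. This is what bounds the kernel off the
    arc. *)
Lemma cayley_separated t d : 0 < d -> exists2 e, 0 < e &
  forall s, d <= `|s - t| -> e <= normc (cayley s - cayley t) ^+ 2.
Proof.
move=> d0; have d20 : 0 < d ^+ 2 by rewrite exprn_gt0.
(* Chosen for [key]: bound [s ^+ 2] by [2 * (s - t) ^+ 2 + 2 * t ^+ 2], then absorb [1 + 2 * t ^+ 2]
   using [d ^+ 2 <= (s - t) ^+ 2]. *)
pose K := 2 + (1 + 2 * t ^+ 2) / d ^+ 2.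
have t20 := sqr_ge0 t.
have K0 : 0 < K by rewrite /K ltr_pwDl// divr_ge0 ?ltW//; lra.
exists (4 / (K * (1 + t ^+ 2))) => [|s dst]; first by rewrite divr_gt0 ?mulr_gt0.
have d2 : d ^+ 2 <= (s - t) ^+ 2.
  by rewrite -[leRHS]real_normK ?num_real// lerXn2r ?nnegrE// ltW.
have st0 : 0 < (s - t) ^+ 2 by exact: lt_le_trans d2.
have key : 1 + s ^+ 2 <= K * (s - t) ^+ 2.
  have h1 : 1 + 2 * t ^+ 2 <= (1 + 2 * t ^+ 2) / d ^+ 2 * (s - t) ^+ 2.
    by rewrite mulrAC ler_pdivlMr// ler_pM2l//; lra.
  have h2 : 0 <= (s - 2 * t) ^+ 2 by exact: sqr_ge0.
  rewrite /K mulrDl; set u := (_ / _ * _) in h1 *; clearbody u.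
  by lra.
have t0 := den_gt0 t.
have -> : 4 / (K * (1 + t ^+ 2)) = 4 / (1 + t ^+ 2) * K^-1.
  by rewrite invfM mulrA mulrAC.
rewrite normc_cayleyB [X in _ <= X](_ : _ =
  4 / (1 + t ^+ 2) * ((s - t) ^+ 2 / (1 + s ^+ 2))); last by field; rewrite !den_neq0.
by rewrite ler_pM2l ?divr_gt0// ler_pdivlMr// ler_pdivrMl.
Qed.

(** Real and imaginary parts are treated together because the induction on [n] mixes them. *)
Lemma continuous_cayleyX n :
  continuous (fun t => Re (cayley t ^+ n)) /\ continuous (fun t => Im (cayley t ^+ n)).
Proof.
have c2 : continuous (fun t : R => (1 + t ^+ 2)^-1).
  move=> t; apply: cvgV => //; apply: cvgD; first exact: cvg_cst.
  exact: exprn_continuous.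
have cR : continuous (fun t => Re (cayley t)).
  move=> t; apply: cvgM; last exact: c2.
  by apply: cvgB; [exact: cvg_cst|exact: exprn_continuous].
have cI : continuous (fun t => Im (cayley t)).
  move=> t; apply: cvgM; last exact: c2.
  by apply: cvgM; [exact: cvg_cst|exact: cvg_id].
elim: n => [|n [IHR IHI]].
  by split=> t; rewrite /continuous_at !expr0; exact: cvg_cst.
split.
  rewrite (_ : (fun t => _) = fun t => Re (cayley t) * Re (cayley t ^+ n)
    - Im (cayley t) * Im (cayley t ^+ n)); last first.
    by apply/funext => t; rewrite exprS ReM.
  move=> t; apply: cvgB; apply: cvgM;
    [exact: cR|exact: IHR|exact: cI|exact: IHI].
rewrite (_ : (fun t => _) = fun t => Re (cayley t) * Im (cayley t ^+ n)
  + Im (cayley t) * Re (cayley t ^+ n)); last first.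
  by apply/funext => t; rewrite exprS ImM.
move=> t; apply: cvgD; apply: cvgM;
  [exact: cR|exact: IHI|exact: cI|exact: IHR].
Qed.

End cayley.

(** * Averages along the powers of a rotation *)

Section bounded_partial_sums.
Variable R : realType.
Local Open Scope complex_scope.
Local Notation normc := (@Normc.normc R).
Local Notation Re := (@complex.Re R).
Implicit Types (u v : nat -> R[i]).

(** Stands for having mean zero: the averages of such a sequence are O(1/J). The class is closed
    under linear combinations, so averages over an orbit are handled without taking limits. *)
Definition bounded_psums u := exists C : R, forall J, normc (\sum_(j < J) u j) <= C.

Lemma bounded_psums_ext u v : u =1 v -> bounded_psums u -> bounded_psums v.
Proof. by move=> uv; rewrite (_ : u = v)//; exact/funext. Qed.

Lemma bounded_psums0 : bounded_psums (fun=> 0).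
Proof. by exists 0 => J; rewrite big1 ?Normc.normc0. Qed.

Lemma bounded_psumsD u v : bounded_psums u -> bounded_psums v ->
  bounded_psums (fun j => u j + v j).
Proof.
move=> [C hC] [D hD]; exists (C + D) => J; rewrite big_split/=.
exact: le_trans (le_normcD _ _) (lerD (hC J) (hD J)).
Qed.

Lemma bounded_psumsZ c u : bounded_psums u -> bounded_psums (fun j => c * u j).
Proof.
move=> [C hC]; exists (normc c * C) => J; rewrite -mulr_sumr Normc.normcM.
exact: ler_wpM2l (normc_ge0 _) _ _ (hC J).
Qed.

Lemma bounded_psums_sum (I : Type) (s : seq I) (f : I -> nat -> R[i]) :
  (forall i, bounded_psums (f i)) -> bounded_psums (fun j => \sum_(i <- s) f i j).
Proof.
move=> hf; elim: s => [|i s IH].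
  by apply: bounded_psums_ext bounded_psums0 => j; rewrite big_nil.
by apply: bounded_psums_ext (bounded_psumsD (hf i) IH) => j; rewrite big_cons.
Qed.

Lemma bounded_psums_geometric w : normc w = 1 -> w != 1 ->
  bounded_psums (fun j => w ^+ j).
Proof.
move=> w1 wn1; exists (2 / normc (w - 1)) => J.
rewrite ler_pdivlMr ?geometric_sum_bound//.
rewrite lt_neqAle normc_ge0 andbT eq_sym; apply: contra wn1 => /eqP h.
by rewrite -subr_eq0; apply/eqP/Normc.eq0_normc.
Qed.

(** The partial sums are at least [J * e], hence unbounded if [e] is positive. This turns a
    pointwise inequality into one between means. *)
Lemma bounded_psums_nonneg (v : nat -> R) e :
  (forall j, 0 <= v j) -> bounded_psums (fun j => (v j + e)%:C) -> e <= 0.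
Proof.
move=> v0 [C hC]; rewrite leNgt; apply/negP => e0.
have [J hJ] : exists J, C / e < J%:R.
  by exists (Num.bound `|C / e|); rewrite (le_lt_trans (ler_norm _))// archi_boundP.
have := hC J; rewrite sum_real_complex normc_real.
apply/negP; rewrite -ltNge big_split/= sumr_const card_ord.
move: hJ; rewrite ltr_pdivrMr// mulr_natl => hJ.
rewrite (lt_le_trans hJ)// (le_trans _ (ler_norm _))// lerDr.
by rewrite sumr_ge0.
Qed.

End bounded_partial_sums.

(** * The Fejer kernel along an orbit *)

Section fejer.
Variable R : realType.
Local Open Scope complex_scope.
Local Notation normc := (@Normc.normc R).
Local Notation Re := (@complex.Re R).

(** [L] times the usual Fejer kernel of order [L], as a squared modulus so that positivity is
    immediate. *)
Definition fejer (L : nat) (w : R[i]) : R := normc (\sum_(i < L) w ^+ i) ^+ 2.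

Lemma fejer_ge0 L w : 0 <= fejer L w. Proof. exact: sqr_ge0. Qed.

Lemma fejer_bound L w e : 0 < e -> normc w = 1 -> e <= normc (w - 1) ^+ 2 ->
  fejer L w <= 4 / e.
Proof.
move=> e0 w1 ew; rewrite ler_pdivlMr//.
have -> : 4 = 2 ^+ 2 :> R by rewrite expr2; lra.
rewrite (@le_trans _ _ (fejer L w * normc (w - 1) ^+ 2))//.
  by rewrite ler_wpM2l// fejer_ge0.
rewrite /fejer -exprMn lerXn2r ?nnegrE ?mulr_ge0 ?normc_ge0//.
exact: geometric_sum_bound.
Qed.

Variables (h z0 : R[i]).
Hypotheses (h1 : normc h = 1) (z01 : normc z0 = 1).
Hypothesis h_inf : forall m, (0 < m)%N -> h ^+ m != 1.

Let h_inj m n : (h ^+ m == h ^+ n) = (m == n).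
Proof.
have h0 := unimodular_neq0 h1.
have aux a b : (a < b)%N -> h ^+ a != h ^+ b.
  move=> ab; apply/negP => /eqP; rewrite -(subnK (ltnW ab)) exprD.
  move=> e; have := h_inf (m := b - a); rewrite subn_gt0 => /(_ ab)/eqP; apply.
  by apply: (mulIf (expf_neq0 a h0)); rewrite -e mul1r.
case: (ltngtP m n) => [mn|nm|->]; last by rewrite eqxx.
- exact/negbTE/aux.
- by rewrite eq_sym; exact/negbTE/aux.
Qed.

Let c (i i' : nat) := z0^-1 ^+ i * z0 ^+ i'.

(** The squared modulus is the sum times its conjugate, and conjugation is inversion on the circle.
    Every term becomes geometric in [j]. *)
Let fejer_expand L k j : (fejer L (h ^+ j / z0))%:C * (h ^+ j) ^+ k =
  \sum_(i < L) \sum_(i' < L) c i i' * (h ^+ i / h ^+ i' * h ^+ k) ^+ j.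
Proof.
have z00 := unimodular_neq0 z01; have h0 := unimodular_neq0 h1.
rewrite /fejer normc_sqrC rmorph_sum/= mulr_suml mulr_suml.
apply: eq_bigr => i _; rewrite mulr_sumr mulr_suml; apply: eq_bigr => i' _.
rewrite rmorphXn/= [X in _ * X ^+ i' * _](_ : _ = (h ^+ j / z0)^-1); last first.
  by apply: unimodular_conjc; rewrite unimodularM ?unimodularX ?unimodularV.
rewrite invf_div /c !exprMn !exprVn -!exprM.
rewrite ![(j * _)%N]mulnC; ring.
Qed.

(** Terms with [i + k] different from [i'] have ratio different from 1, since [h] has infinite
    order, and so have bounded partial sums. The remaining terms are constant in [j] and are
    subtracted. *)
Lemma fejer_bounded_psums L k : bounded_psums (fun j =>
  (fejer L (h ^+ j / z0))%:C * (h ^+ j) ^+ k -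
  \sum_(i < L) \sum_(i' < L | (i + k)%N == i') c i i').
Proof.
have h0 := unimodular_neq0 h1.
apply: (@bounded_psums_ext _ (fun j => \sum_(i < L) \sum_(i' < L)
    (c i i' * (h ^+ i / h ^+ i' * h ^+ k) ^+ j - (if (i + k)%N == i' then c i i' else 0)))).
  move=> j; rewrite fejer_expand -sumrB; apply: eq_bigr => i _.
  by rewrite sumrB; congr (_ - _); rewrite [RHS]big_mkcond.
apply: bounded_psums_sum => i; apply: bounded_psums_sum => i'.
have -> : h ^+ i / h ^+ i' * h ^+ k = h ^+ (i + k) / h ^+ i' by rewrite exprD mulrAC.
have [->|ne] := eqVneq (i + k)%N i'.
  apply: bounded_psums_ext (bounded_psums0 R) => j.
  by rewrite divff ?expf_neq0// expr1n mulr1 subrr.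
apply: bounded_psums_ext (bounded_psumsZ (c i i')
  (bounded_psums_geometric (w := h ^+ (i + k) / h ^+ i') _ _)).
- by move=> j; rewrite subr0.
- by rewrite unimodularM ?unimodularV ?unimodularX.
- apply: contra ne => /eqP e; rewrite -h_inj.
  have hi' : h ^+ i' != 0 by rewrite expf_neq0.
  by rewrite -(divfK hi' (h ^+ (i + k))) e mul1r.
Qed.

(** For [k = 0] the constant terms are the [L] diagonal ones, each equal to 1. *)
Lemma fejer_mean L : bounded_psums (fun j => (fejer L (h ^+ j / z0) - L%:R)%:C).
Proof.
apply: bounded_psums_ext (fejer_bounded_psums L 0) => j.
rewrite expr0 mulr1 rmorphB/= rmorph_nat; congr (_ - _).
rewrite -[in RHS](card_ord L) -sumr_const; apply: eq_bigr => i _.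
rewrite (big_pred1 i) => [|i']; last by rewrite addn0 eq_sym.
by rewrite /c exprVn mulVf// expf_neq0// unimodular_neq0.
Qed.

(** The kernel has degree below [L], so it is orthogonal to the power [k]: no [i' < L] equals
    [i + k]. *)
Lemma fejer_mean_mul L k : (L <= k)%N ->
  bounded_psums (fun j => (fejer L (h ^+ j / z0) * Re ((h ^+ j) ^+ k))%:C).
Proof.
move=> Lk; have [C hC] := fejer_bounded_psums L k; exists C => J.
apply: le_trans (hC J).
rewrite sum_real_complex normc_real.
apply: le_trans (abs_Re_le_normc _).
rewrite le_eqVlt; apply/orP; left; apply/eqP; congr (`|_|).
rewrite (raddf_sum (complex.Re (R := R))); apply: eq_bigr => j _.
rewrite [X in _ - X]big1 ?subr0 => [|i _].
  by case: (_ ^+ k) => a b /=; rewrite mul0r subr0.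
apply: big_pred0 => i'; apply/eqP => e.
by have := ltn_ord i'; rewrite -e ltnNge (leq_trans Lk)// leq_addl.
Qed.

End fejer.

(* Baire: the closed sets {t | |g N t - g N' t| <= e for N, N' >= M} cover R. *)
Lemma baire_uniform_cauchy (R : realType) (g : nat -> R -> R) (e : R) :
  (forall N, continuous (g N)) -> (forall t, cvgn (g^~ t)) -> 0 < e ->
  exists t0 d M, 0 < d /\ forall t N N', `|t - t0| < d ->
    (M <= N)%N -> (M <= N')%N -> `|g N t - g N' t| <= e.
Proof.
move=> gc gcvg e0.
pose E M := [set t | exists N N', [/\ (M <= N)%N, (M <= N')%N & e < `|g N t - g N' t|]].
have oE M : open (E M).
  rewrite (_ : E M = \bigcup_(N in [set N | (M <= N)%N])
      \bigcup_(N' in [set N' | (M <= N')%N]) [set t | e < `|g N t - g N' t|]); last first.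
    apply/seteqP; split=> t /=; first by move=> [N [N' [? ? ?]]]; exists N => //; exists N'.
    by move=> [N /= ? [N' /= ? ?]]; exists N, N'.
  apply: bigcup_open => N _; apply: bigcup_open => N' _.
  rewrite (_ : [set t | _] = (fun t => `|g N t - g N' t|) @^-1` [set y | e < y])//.
  apply: open_comp; last exact: open_gt.
  by move=> t _; apply: cvg_norm; apply: cvgB; exact: gc.
(* Otherwise all these open sets are dense and Baire gives a point in their intersection, where the
   sequence violates the Cauchy criterion. *)
have [M ndE] : exists M, ~ dense (E M).
  apply: contrapT => /forallNP dE.
  have := @Baire R R E (fun M => conj (oE M) (contrapT (dE M))).
  move=> /(_ setT) []; [by exists 0|exact: openT|move=> t [_ tE]].
  have /cvgrPdist_lt/(_ (e / 2)) := gcvg t; rewrite divr_gt0// => /(_ isT)[M _ hM].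
  have [N [N' [MN MN' eN]]] := tE M I.
  have := hM _ MN; have := hM _ MN'; set l : R := limn _ => /= h1 h2.
  move: eN; apply/negP; rewrite -leNgt.
  rewrite (_ : g N t - g N' t = (l - g N' t) - (l - g N t)); last by ring.
  by rewrite (le_trans (ler_normB _ _))//; move: h1 h2; lra.
have /denseNE[U [[t0 [oU Ut0]] UE]] := ndE.
have [d d0 dO] : exists2 d, 0 < d & forall t, `|t - t0| < d -> U t.
  have /nbhs_ballP[d /= d0 dO] := open_nbhs_nbhs (conj oU Ut0).
  by exists d => // t td; apply: dO; rewrite /ball/= distrC.
exists t0, d, M; split=> // t N N' /dO Ot MN MN'; rewrite leNgt; apply/negP => eN.
by have : (U `&` E M) t by [split=> //; exists N, N']; rewrite UE.
Qed.

(** * Contradiction at a rotation of infinite order *)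

Section rigid_power.
Variables (R : realType) (k : nat -> nat).
Local Open Scope complex_scope.
Local Notation normc := (@Normc.normc R).
Local Notation Re := (@complex.Re R).

(** On the circle [1 - Re w] is half of [|w - 1|^2]; this form is linear in the powers of [z], so
    orthogonality to the kernel applies. *)
Definition mean_defect (N : nat) (z : R[i]) : R :=
  N%:R^-1 * \sum_(1 <= n < N.+1) (1 - Re (z ^+ k n)).

Lemma mean_defect_bound N z : normc z = 1 -> 0 <= mean_defect N z <= 2.
Proof.
move=> z1; have b n : -1 <= Re (z ^+ k n) <= 1 by rewrite unimodular_Re// unimodularX.
rewrite /mean_defect mulr_ge0 ?invr_ge0//=; last first.
  by apply: sumr_ge0 => n _; have := b n; lra.
have [->|N0] := posnP N; first by rewrite invr0 mul0r.
rewrite ler_pdivrMl ?ltr0n// (le_trans (ler_sum _ (G := fun=> 2) _))//.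
  by move=> n _; have := b n; lra.
by rewrite sumr_const_nat subn1/= mulr_natl.
Qed.

(** The limit is known to be 0 only at the powers of [h], which may be a null set; hence the kernel
    is averaged over these powers and not over the whole circle. *)
Lemma no_convergence_at_infinite_order (h : R[i]) :
  normc h = 1 -> (forall m, (0 < m)%N -> h ^+ m != 1) ->
  (forall L, exists n1, forall n, (n1 <= n)%N -> (L <= k n)%N) ->
  (forall z, normc z = 1 -> cvgn (mean_defect^~ z)) ->
  (forall j, mean_defect ^~ (h ^+ j) @ \oo --> 0) -> False.
Proof.
move=> h1 h_inf k_inf Dcvg Dh.
have [N|t|//|t0 [d [M [d0 hM]]]] :=
    @baire_uniform_cauchy R (fun N t => mean_defect N (cayley t)) (1 / 4).
- move=> t; apply: cvgM; first exact: cvg_cst.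
  apply: cvg_big => [|n _]; first exact: add_continuous.
  by apply: cvgB; [exact: cvg_cst|exact: (continuous_cayleyX R (k n)).1].
- exact/Dcvg/normc_cayley.
pose z0 := cayley t0; have z01 : normc z0 = 1 := normc_cayley t0.
have [e e0 he] := cayley_separated t0 d0.
have near_z0 N j : (M <= N)%N -> normc (h ^+ j - z0) ^+ 2 < e ->
    mean_defect N (h ^+ j) <= 1 / 4.
  move=> MN je.
  (* The chart misses only -1, which is not a power of [h]: its square is 1, and [h ^+ 0] is 1. *)
  have [|t tE] := cayley_surj (unimodularX j h1).
    apply/eqP => hj; have [j0|j0] := posnP j.
      move: hj; rewrite j0 expr0 => /eqP; rewrite -subr_eq0 opprK.
      by rewrite -(natrD _ 1 1) pnatr_eq0.
    have := h_inf (j * 2)%N; rewrite muln_gt0 j0 => /(_ isT).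
    by rewrite exprM hj sqrrN expr1n eqxx.
  have td : `|t - t0| < d.
    by rewrite ltNge; apply/negP => /he; rewrite leNgt -tE je.
  have hN := hM t N _ td MN; rewrite -tE in hN.
  (* The second index of the Cauchy bound is sent to infinity, where the defect at [h ^+ j]
     vanishes. *)
  apply/ler_addgt0Pr => r r0; have /cvgrPdist_lt/(_ r r0)[N' _ hN'] := Dh j.
  have := hN (maxn M N') (leq_maxl _ _); have := hN' (maxn M N') (leq_maxr _ _).
  rewrite /= sub0r normrN => a b.
  have := ler_norm (mean_defect (maxn M N') (h ^+ j)).
  have := ler_norm (mean_defect N (h ^+ j) - mean_defect (maxn M N') (h ^+ j)).
  by lra.
(* The final comparison is between [L / 2] and the contribution [8 / e] from outside the arc. *)
pose L := (Num.bound (16 / e)).+1.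
have Le : 16 / e < L%:R.
  rewrite (lt_trans (archi_boundP _)) ?ltr_nat//.
  by rewrite divr_ge0// ltW.
have [n1 hn1] := k_inf L.
(* Beyond [M] the bound on the arc holds; beyond [4 * n1.+1] at least three quarters of the indices
   exceed [n1], so that [m - N / 4] is at least [N / 2]. *)
pose N := (maxn M (4 * n1.+1))%N.
have MN : (M <= N)%N by exact: leq_maxl.
have nN : (4 * n1.+1 <= N)%N by exact: leq_maxr.
have N0 : (0 < N)%N by apply: leq_trans nN.
have NR0 : 0 < N%:R :> R by rewrite ltr0n.
pose F j := fejer L (h ^+ j / z0).
pose m := (N - n1)%N.
(* [N] times the slack in [FD] below, increased by the nonnegative terms of index at most [n1],
   whose exponents may be smaller than [L]. *)
pose v j := N%:R * (F j / 4 + 8 / e) - m%:R * F j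
  + \sum_(n1.+1 <= n < N.+1) F j * Re ((h ^+ j) ^+ k n).
have v0 j : 0 <= v j.
  have hj1 := unimodularX j h1.
  have Re1 n : -1 <= Re ((h ^+ j) ^+ k n) <= 1 by rewrite unimodular_Re// unimodularX.
  have F0 : 0 <= F j := fejer_ge0 _ _.
  (* On the arc the defect is at most 1/4; off it the kernel is at most [4 / e] and the defect at
     most 2. *)
  have FD : F j * mean_defect N (h ^+ j) <= F j / 4 + 8 / e.
    have [De|De] := ltP (normc (h ^+ j - z0) ^+ 2) e.
      have := near_z0 _ _ MN De => hD; apply: (@le_trans _ _ (F j * (1 / 4))).
        by rewrite ler_wpM2l.
      by rewrite mul1r lerDl divr_ge0// ltW.
    have Fe : F j <= 4 / e.
      apply: fejer_bound => //; first by rewrite unimodularM ?unimodularV.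
      have z00 := unimodular_neq0 z01.
      rewrite (_ : _ - 1 = (h ^+ j - z0) / z0); last by rewrite mulrBl divff.
      by rewrite Normc.normcM (unimodularV z01) mulr1.
    have /andP[D0 D2] := mean_defect_bound N hj1.
    apply: (@le_trans _ _ (4 / e * 2)); first by rewrite ler_pM.
    by rewrite mulrAC -natrM lerDr divr_ge0.
  have : N%:R * (F j * mean_defect N (h ^+ j)) =
      F j * \sum_(1 <= n < N.+1) (1 - Re ((h ^+ j) ^+ k n)).
    by rewrite /mean_defect; field; rewrite gt_eqF.
  have n1N : (n1.+1 <= N.+1)%N by rewrite ltnS (leq_trans _ nN)//; lia.
  rewrite (big_cat_nat (n := n1.+1))//= mulrDr => e1.
  have e2 : 0 <= F j * \sum_(1 <= n < n1.+1) (1 - Re ((h ^+ j) ^+ k n)).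
    by rewrite mulr_ge0// sumr_ge0// => n _; have := Re1 n; lra.
  have e3 : F j * \sum_(n1.+1 <= n < N.+1) (1 - Re ((h ^+ j) ^+ k n)) =
      m%:R * F j - \sum_(n1.+1 <= n < N.+1) F j * Re ((h ^+ j) ^+ k n).
    rewrite sumrB sumr_const_nat subSS -/m mulrBr mulr_sumr; congr (_ - _).
    by rewrite mulrC.
  have e4 : N%:R * (F j * mean_defect N (h ^+ j)) <= N%:R * (F j / 4 + 8 / e).
    by rewrite ler_pM2l.
  rewrite /v; lra.
(* The left side is minus the mean of [v], because the kernel has mean [L] and its products with
   powers of exponent at least [L] have mean 0. *)
have : (m%:R - N%:R / 4) * L%:R - N%:R * (8 / e) <= 0.
  apply: (bounded_psums_nonneg v0).
  have b1 := bounded_psumsZ (N%:R / 4 - m%:R)%:C (fejer_mean h1 z01 h_inf L).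
  (* The test holds throughout the range; it is there because [bounded_psums_sum] wants a bound for
     every index. *)
  have b2 : bounded_psums (fun j => \sum_(n1.+1 <= n < N.+1)
      (if (n1 <= n)%N then (F j * Re ((h ^+ j) ^+ k n))%:C else 0)).
    apply: bounded_psums_sum => n; have [nn|_] := boolP (n1 <= n)%N;
      last exact: bounded_psums0.
    by apply: (fejer_mean_mul h1 z01 h_inf); exact: hn1.
  apply: bounded_psums_ext (bounded_psumsD b1 b2) => j.
  rewrite (eq_big_nat _ _ (F2 := fun n => (F j * Re ((h ^+ j) ^+ k n))%:C)); last first.
    by move=> n /andP[/ltnW -> _].
  rewrite sum_real_complex -rmorphM -rmorphD; congr (_%:C).
  by rewrite /v -/(F j); lra.
have mE : N%:R = m%:R + n1%:R :> R.
  by rewrite -natrD subnK// (leq_trans _ nN)//; lia.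
have nNR : 4 * (n1%:R + 1) <= N%:R :> R.
  by rewrite natr1 -natrM ler_nat.
move=> H.
have h2 : N%:R / 2 * L%:R <= (m%:R - N%:R / 4) * L%:R :> R.
  by rewrite ler_wpM2r//; lra.
have h3 : N%:R / 2 * (16 / e) < N%:R / 2 * L%:R.
  by rewrite ltr_pM2l// divr_gt0.
have h4 : N%:R / 2 * (16 / e) = N%:R * (8 / e) :> R by field; rewrite gt_eqF.
lra.
Qed.

End rigid_power.

(** * Bounded convergence for complex measures *)

Section bounded_integrals.
Context d (T : measurableType d) (R : realType).
Implicit Types (f g : T -> R) (m : {finite_measure set T -> \bar R}).

(** Such functions are integrable for every finite measure, so integrability reduces to closure
    properties of this class. *)
Definition bounded_measurable f :=
  measurable_fun setT f /\ exists C, forall x, `|f x| <= C.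

Lemma bounded_measurable_integrable m f :
  bounded_measurable f -> m.-integrable setT (EFin \o f).
Proof.
move=> [mf [C fC]]; apply: measurable_bounded_integrable => //.
  by rewrite ltey_eq fin_num_measure.
by exists C; split; [exact: num_real|move=> y Cy x _; exact: le_trans (ltW Cy)].
Qed.

Lemma bounded_measurable_cst (a : R) : bounded_measurable (fun=> a).
Proof. by split; [exact: measurable_cst|exists `|a|]. Qed.

Lemma bounded_measurableD f g : bounded_measurable f -> bounded_measurable g ->
  bounded_measurable (fun x => f x + g x).
Proof.
move=> [mf [C fC]] [mg [D gD]]; split; first exact: measurable_funD.
by exists (C + D) => x; exact: le_trans (ler_normD _ _) (lerD (fC x) (gD x)).
Qed.

Lemma bounded_measurableM f g : bounded_measurable f -> bounded_measurable g ->
  bounded_measurable (fun x => f x * g x).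
Proof.
move=> [mf [C fC]] [mg [D gD]]; split; first exact: measurable_funM.
by exists (C * D) => x; rewrite normrM ler_pM.
Qed.

Lemma bounded_measurableB f g : bounded_measurable f -> bounded_measurable g ->
  bounded_measurable (fun x => f x - g x).
Proof.
move=> [mf [C fC]] [mg [D gD]]; split; first exact: measurable_funB.
by exists (C + D) => x; exact: le_trans (ler_normB _ _) (lerD (fC x) (gD x)).
Qed.

Lemma normr_Rintegral_bound m f C : bounded_measurable f -> (forall x, `|f x| <= C) ->
  `|\int[m]_x f x| <= fine (m setT) * C.
Proof.
move=> bf fC; have intf := bounded_measurable_integrable m bf.
rewrite (le_trans (le_normr_Rintegral measurableT intf))//.
rewrite mulrC -(Rintegral_cst m measurableT).
apply: le_Rintegral => //; last exact: (bounded_measurable_integrable m (bounded_measurable_cst C)).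
exact: integrable_norm.
Qed.

Lemma Rintegral_bounded_cvg m (u : nat -> T -> R) f C :
  (forall n, measurable_fun setT (u n)) -> measurable_fun setT f ->
  (forall n x, `|u n x| <= C) -> {ae m, forall x, u ^~ x @ \oo --> f x} ->
  (fun n => \int[m]_x u n x) @ \oo --> \int[m]_x f x.
Proof.
move=> mu mf uC uf.
have [] := @dominated_convergence _ T R m setT measurableT
  (fun n x => (u n x)%:E) (fun x => (f x)%:E) (cst C%:E).
- by move=> n; exact/measurable_EFinP.
- exact/measurable_EFinP.
- by apply: filterS uf => x ux _; apply: cvg_EFin => //; exact: nearW.
- exact: (bounded_measurable_integrable m (bounded_measurable_cst C)).
- by apply: aeW => x n _; rewrite lee_fin.
move=> /integrable_fin_num fin _ /=.
rewrite -(@fineK _ (\int[m]_x (f x)%:E)%E); last exact: fin.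
by move=> /fine_cvgP[].
Qed.

(** The fibres of an injection of [S] into the naturals are empty or singletons. *)
Lemma countable_negligible (m : {measure set T -> \bar R}) (S : set T) :
  countable S -> (forall a, measurable [set a] /\ m [set a] = 0%E) -> m.-negligible S.
Proof.
move=> /countable_injP[f finj] mS.
rewrite (_ : S = \bigcup_n [set x | S x /\ f x = n]); last first.
  by apply/seteqP; split=> [x Sx|x [n _ []//]]; exists (f x).
apply: negligible_bigcup => n.
have [[a [Sa fa]]|ne] := pselect (exists a, S a /\ f a = n); last first.
  by exists set0; split => // x [Sx fx]; apply: ne; exists x.
exists [set a]; have [ma a0] := mS a; split => // x [Sx fx] /=.
by apply: finj; rewrite ?inE// fa.
Qed.

End bounded_integrals.

(** * Integrals against a signed measure *)

Section charge_integrals.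
Context d (T : measurableType d) (R : realType) (nu : {charge set T -> \bar R}).
Implicit Types f g : T -> R.

(** Up to sign, both parts at [A] are values of [nu] on subsets of [A]. All subsets must be null,
    since [nu A = 0] alone could come from cancellation. *)
Lemma jordan_null P N (PN : hahn_decomposition nu P N) A : measurable A ->
  (forall B, measurable B -> B `<=` A -> nu B = 0%E) ->
  jordan_pos PN A = 0%E /\ jordan_neg PN A = 0%E.
Proof.
move=> mA A0; have [[mP _] [mN _] _ _] := PN.
rewrite jordan_posE cjordan_posE jordan_negE cjordan_negE /crestr0 mem_set// /crestr.
by rewrite !A0 ?oppe0//; exact: measurableI.
Qed.

(** Hides the chosen Hahn decomposition behind two finite measures. *)
Lemma charge_integral_split : exists m1 m2 : {finite_measure set T -> \bar R},
  (forall f, charge_integral nu f = \int[m1]_x f x - \int[m2]_x f x) /\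
  (forall A, measurable A -> (forall B, measurable B -> B `<=` A -> nu B = 0%E) ->
    m1 A = 0%E /\ m2 A = 0%E).
Proof.
pose PN := projT2 (cid (projT2 (cid (Hahn_decomposition nu)))).
exists (jordan_pos PN), (jordan_neg PN).
by split=> // A mA A0; exact: jordan_null.
Qed.

(** On the negative set [nu] is both nonpositive and equal to a measure, so the negative part
    vanishes. *)
Lemma jordan_measure P N (PN : hahn_decomposition nu P N)
    (m : {measure set T -> \bar R}) A :
  (forall A, measurable A -> nu A = m A) -> measurable A ->
  jordan_pos PN A = m A /\ jordan_neg PN A = 0%E.
Proof.
move=> num mA; have [[mP _] [mN neg] _ _] := PN.
have neg0 : jordan_neg PN A = 0%E.
  rewrite jordan_negE cjordan_negE /crestr0 mem_set// /crestr.
  have mAN : measurable (A `&` N) by exact: measurableI.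
  have -> : nu (A `&` N) = 0%E; last by rewrite oppe0.
  by apply/eqP; rewrite eq_le (neg _ mAN (@subIsetr _ _ _))/= num.
split=> //; rewrite -num// (jordan_decomp PN mA) /cadd/= cscaleN1.
by move: neg0 => /= ->; rewrite oppe0 adde0.
Qed.

Lemma charge_integral_measure (m : {measure set T -> \bar R}) f :
  (forall A, measurable A -> nu A = m A) -> charge_integral nu f = \int[m]_x f x.
Proof.
move=> num; pose PN := projT2 (cid (projT2 (cid (Hahn_decomposition nu)))).
rewrite /charge_integral -/PN /Rintegral (eq_measure_integral m); last first.
  by move=> A mA _; have [] := jordan_measure PN num mA.
rewrite (eq_measure_integral (m1 := jordan_neg PN) mzero); last first.
  by move=> A mA _; have [] := jordan_measure PN num mA.
by rewrite integral_measure_zero subr0.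
Qed.

Lemma charge_integralP f g a : bounded_measurable f -> bounded_measurable g ->
  charge_integral nu (fun x => a * f x + g x) =
  a * charge_integral nu f + charge_integral nu g.
Proof.
move=> bf bg; have [m1 [m2 [E _]]] := charge_integral_split.
have baf := bounded_measurableM (bounded_measurable_cst T a) bf.
rewrite !E !RintegralD ?RintegralZl//; try exact: bounded_measurable_integrable.
by ring.
Qed.

Lemma charge_integral_bound : exists K, forall f C, bounded_measurable f ->
  (forall x, `|f x| <= C) -> `|charge_integral nu f| <= K * C.
Proof.
have [m1 [m2 [E _]]] := charge_integral_split.
exists (fine (m1 setT) + fine (m2 setT)) => f C bf fC.
by rewrite E mulrDl (le_trans (ler_normB _ _))// lerD// normr_Rintegral_bound.
Qed.

(** A singleton has only trivial subsets, so the Jordan parts have no atoms either; the countable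
    set [S] is null for both, and bounded convergence applies to each. *)
Lemma charge_integral_cvg0 (S : set T) (u : nat -> T -> R) C :
  (forall a, measurable [set a] /\ nu [set a] = 0%E) -> countable S ->
  (forall n, measurable_fun setT (u n)) -> (forall n x, `|u n x| <= C) ->
  (forall x, ~ S x -> u ^~ x @ \oo --> 0) ->
  (fun n => charge_integral nu (u n)) @ \oo --> 0.
Proof.
move=> nu0 cS mu uC u0; have [m1 [m2 [E E0]]] := charge_integral_split.
have m0 a : m1 [set a] = 0%E /\ m2 [set a] = 0%E.
  apply: E0 => [|B mB]; first by have [] := nu0 a.
  by move=> /subset_set1[]->; [exact: charge0|have [] := nu0 a].
rewrite (_ : (fun n => _) = fun n => \int[m1]_x u n x - \int[m2]_x u n x); last first.
  by apply/funext => n; rewrite E.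
rewrite (_ : 0 = \int[m1]_x (0 : R) - \int[m2]_x (0 : R)); last first.
  by rewrite !Rintegral_cst// !mul0r subr0.
have sub : ~` [set x | u ^~ x @ \oo --> 0] `<=` S.
  by move=> x /= ux; apply: contrapT => /u0.
by apply: cvgB; apply: Rintegral_bounded_cvg uC _ => //;
  apply: negligibleS sub _; apply: countable_negligible => // a;
  have [] := nu0 a; have [] := m0 a.
Qed.

End charge_integrals.

(** * Integrals against a complex measure *)

Section complex_integrals.
Context d (T : measurableType d) (R : realType).
Local Open Scope complex_scope.
Local Notation normc := (@Normc.normc R).
Local Notation Re := (@complex.Re R).
Local Notation Im := (@complex.Im R).
Implicit Types f g : T -> R[i].

Lemma cvg0_le (u v : nat -> R) : (forall n, `|u n| <= v n) ->
  v @ \oo --> 0 -> u @ \oo --> 0.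
Proof.
move=> uv v0; apply/norm_cvg0P.
by apply: (squeeze_cvgr _ (cvg_cst 0) v0); apply: nearW => n; rewrite normr_ge0 uv.
Qed.

Definition bounded_cmeasurable f :=
  bounded_measurable (fun x => Re (f x)) /\ bounded_measurable (fun x => Im (f x)).

Lemma bounded_cmeasurable_cst a : bounded_cmeasurable (fun=> a).
Proof. by split; exact: bounded_measurable_cst. Qed.

Lemma bounded_cmeasurableD f g : bounded_cmeasurable f -> bounded_cmeasurable g ->
  bounded_cmeasurable (fun x => f x + g x).
Proof.
move=> [bf1 bf2] [bg1 bg2]; split.
  by rewrite (funext (fun x => ReD (f x) (g x))); exact: bounded_measurableD.
by rewrite (funext (fun x => ImD (f x) (g x))); exact: bounded_measurableD.
Qed.

Lemma bounded_cmeasurableM f g : bounded_cmeasurable f -> bounded_cmeasurable g ->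
  bounded_cmeasurable (fun x => f x * g x).
Proof.
move=> [bf1 bf2] [bg1 bg2]; split.
  rewrite (funext (fun x => ReM (f x) (g x))).
  by apply: bounded_measurableB; exact: bounded_measurableM.
rewrite (funext (fun x => ImM (f x) (g x))).
by apply: bounded_measurableD; exact: bounded_measurableM.
Qed.

Lemma bounded_cmeasurable_sum (I : Type) (s : seq I) (a : I -> R[i]) (f : I -> T -> R[i]) :
  (forall i, bounded_cmeasurable (f i)) ->
  bounded_cmeasurable (fun x => \sum_(i <- s) a i * f i x).
Proof.
move=> bf; elim: s => [|i s IH].
  rewrite (_ : (fun x => _) = fun=> 0); last by apply/funext => x; rewrite big_nil.
  exact: bounded_cmeasurable_cst.
rewrite (_ : (fun x => _) = fun x => a i * f i x + \sum_(i <- s) a i * f i x); last first.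
  by apply/funext => x; rewrite big_cons.
apply: bounded_cmeasurableD => //; apply: bounded_cmeasurableM => //.
exact: bounded_cmeasurable_cst.
Qed.

Variable mu : complex_measure T R.

Lemma cmeasure_integralP f g a : bounded_cmeasurable f -> bounded_cmeasurable g ->
  cmeasure_integral mu (fun x => a * f x + g x) =
  a * cmeasure_integral mu f + cmeasure_integral mu g.
Proof.
move=> [fR fI] [gR gI]; rewrite /cmeasure_integral.
rewrite (_ : (fun x => Re (a * f x + g x)) = fun x =>
    Re a * Re (f x) + (- Im a * Im (f x) + Re (g x))); last first.
  by apply/funext => x; rewrite ReD ReM; ring.
rewrite (_ : (fun x => Im (a * f x + g x)) = fun x =>
    Re a * Im (f x) + (Im a * Re (f x) + Im (g x))); last first.
  by apply/funext => x; rewrite ImD ImM; ring.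
have b1 : bounded_measurable (fun x => - Im a * Im (f x) + Re (g x)).
  by apply: bounded_measurableD => //; apply: bounded_measurableM => //;
    exact: bounded_measurable_cst.
have b2 : bounded_measurable (fun x => Im a * Re (f x) + Im (g x)).
  by apply: bounded_measurableD => //; apply: bounded_measurableM => //;
    exact: bounded_measurable_cst.
rewrite !charge_integralP//.
by apply/eqP; rewrite eq_complex; case: (a) => a1 a2 /=;
  apply/andP; split; apply/eqP; ring.
Qed.

Lemma cmeasure_integral0 : cmeasure_integral mu (fun=> 0) = 0.
Proof.
have b0 := bounded_cmeasurable_cst 0.
have := cmeasure_integralP 1 b0 b0; rewrite !mul1r addr0.
by move/eqP; rewrite -subr_eq0 opprD addrA subrr sub0r oppr_eq0 => /eqP.
Qed.

Lemma cmeasure_integral_sum (I : Type) (s : seq I) (a : I -> R[i]) (f : I -> T -> R[i]) :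
  (forall i, bounded_cmeasurable (f i)) ->
  cmeasure_integral mu (fun x => \sum_(i <- s) a i * f i x) =
  \sum_(i <- s) a i * cmeasure_integral mu (f i).
Proof.
move=> bf; elim: s => [|i s IH].
  rewrite (_ : (fun x => _) = fun=> 0); last by apply/funext => x; rewrite big_nil.
  by rewrite big_nil cmeasure_integral0.
rewrite (_ : (fun x => _) = fun x => a i * f i x + \sum_(i <- s) a i * f i x); last first.
  by apply/funext => x; rewrite big_cons.
by rewrite cmeasure_integralP ?big_cons ?IH//; exact: bounded_cmeasurable_sum.
Qed.

Lemma cmeasure_integral_bound : exists K, forall f C, bounded_cmeasurable f ->
  (forall x, normc (f x) <= C) -> normc (cmeasure_integral mu f) <= K * C.
Proof.
have [K1 h1] := charge_integral_bound (cmeasure_Re mu).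
have [K2 h2] := charge_integral_bound (cmeasure_Im mu).
(* Each of the two charges is integrated against both the real and the imaginary part of [f]. *)
exists (2 * (K1 + K2)) => f C [fR fI] fC.
have RC x : `|Re (f x)| <= C := le_trans (abs_Re_le_normc _) (fC x).
have IC x : `|Im (f x)| <= C := le_trans (abs_Im_le_normc _) (fC x).
rewrite (le_trans (normc_le_ReIm _))//=.
have := h1 _ C fR RC; have := h2 _ C fR RC; have := h1 _ C fI IC; have := h2 _ C fI IC.
set x1 := charge_integral _ _; set x2 := charge_integral _ _.
set x3 := charge_integral _ _; set x4 := charge_integral _ _ => i1 i2 i3 i4.
have := ler_normB x4 x1; have := ler_normD x2 x3; lra.
Qed.

Lemma cmeasure_integral_cvg0 (S : set T) (u : nat -> T -> R[i]) C :
  (forall a, measurable [set a] /\ mu [set a] = 0) -> countable S ->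
  (forall n, bounded_cmeasurable (u n)) -> (forall n x, normc (u n x) <= C) ->
  (forall x, ~ S x -> (fun n => normc (u n x)) @ \oo --> 0) ->
  (fun n => normc (cmeasure_integral mu (u n))) @ \oo --> 0.
Proof.
move=> mu0 cS bu uC u0.
have R0 a : measurable [set a] /\ cmeasure_Re mu [set a] = 0%E.
  by have [? h] := mu0 a; rewrite /cmeasure_Re h.
have I0 a : measurable [set a] /\ cmeasure_Im mu [set a] = 0%E.
  by have [? h] := mu0 a; rewrite /cmeasure_Im h.
have mR n : measurable_fun setT (fun x => Re (u n x)) by have [[]] := bu n.
have mI n : measurable_fun setT (fun x => Im (u n x)) by have [_ []] := bu n.
have RC n x : `|Re (u n x)| <= C := le_trans (abs_Re_le_normc _) (uC n x).
have IC n x : `|Im (u n x)| <= C := le_trans (abs_Im_le_normc _) (uC n x).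
have Ru x : ~ S x -> (fun n => Re (u n x)) @ \oo --> 0.
  by move=> /u0; apply: cvg0_le => n; exact: abs_Re_le_normc.
have Iu x : ~ S x -> (fun n => Im (u n x)) @ \oo --> 0.
  by move=> /u0; apply: cvg0_le => n; exact: abs_Im_le_normc.
have c1 := charge_integral_cvg0 R0 cS mR RC Ru.
have c2 := charge_integral_cvg0 R0 cS mI IC Iu.
have c3 := charge_integral_cvg0 I0 cS mR RC Ru.
have c4 := charge_integral_cvg0 I0 cS mI IC Iu.
pose I n := cmeasure_integral mu (u n).
have cI : (fun n => `|Re (I n)| + `|Im (I n)|) @ \oo --> `|0 - 0 : R| + `|0 + 0 : R|.
  by apply: cvgD; apply: cvg_norm; [exact: cvgB c1 c4|exact: cvgD c2 c3].
move: cI; rewrite subr0 addr0 normr0 addr0.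
by apply: cvg0_le => n; rewrite ger0_norm ?normc_ge0// normc_le_ReIm.
Qed.

End complex_integrals.

(** * Fourier coefficients on the circle *)

Section circle_functions.
Variable R : realType.
Local Open Scope complex_scope.
Local Notation normc := (@Normc.normc R).
Local Notation Re := (@complex.Re R).
Local Notation Im := (@complex.Im R).

Lemma circle_normc (z : circle R) : normc z = 1.
Proof.
have := set_valP z; rewrite /unit_circle/= Defs.normcE => h.
by apply: complexI; rewrite -Defs.normcE; exact: h.
Qed.

Lemma circle_ex (z : R[i]) : normc z = 1 -> exists w : circle R, (w : R[i]) = z.
Proof.
move=> z1; have zS : z \in @unit_circle R by rewrite inE /unit_circle/= Defs.normcE z1.
by exists (SigSub zS).
Qed.

Lemma circle_val_inj : injective (@circle_val R).
Proof. exact: val_inj. Qed.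

Lemma circle_val_continuous : continuous (@circle_val R : circle R -> R[i]).
Proof. exact: initial_continuous. Qed.

Lemma continuous_circle_measurable (g : circle R -> R) :
  continuous g -> measurable_fun setT (g : borel_circle R -> R).
Proof.
move=> gc; apply: (measurability _ (RGenOInfty.measurableE R)) => //= _ [_ [x ->] <-].
rewrite setTI; apply: sub_sigma_algebra.
by apply: open_comp => [z _|]; [exact: gc|exact: interval_open].
Qed.

Lemma circle_measurable_set1 (a : borel_circle R) : measurable [set a].
Proof.
rewrite -[[set a]]setCK; apply: measurableC; apply: sub_sigma_algebra.
rewrite openC.
have -> : [set a] = @circle_val R @^-1` [set circle_val a].
  by apply/seteqP; split=> z /= => [->//|/circle_val_inj].
apply: closed_comp; first by move=> z _; exact: circle_val_continuous.
apply: accessible_closed_set1; apply: hausdorff_accessible; exact: norm_hausdorff.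
Qed.

Lemma continuous_ReIm : continuous Re /\ continuous Im.
Proof.
have near z e : 0 < e -> \forall t \near z, normc (z - t) < e.
  move=> e0; have e0C : 0 < e%:C :> R[i] by rewrite ltcR.
  apply: (@filterS _ _ (nbhs_filter z) _ _ _ (nbhsx_ballx z _ e0C)) => t.
  by rewrite -ball_normE/= Defs.normcE ltcR.
have lim (f : R[i] -> R) : (forall z t, `|f z - f t| <= normc (z - t)) -> continuous f.
  move=> fl z; apply/(@cvgrPdist_lt _ _ _ _ (nbhs_filter z)) => e e0.
  by apply: (@filterS _ _ (nbhs_filter z) _ _ _ (near z e e0)) => t; exact: le_lt_trans.
by split; apply: lim => z t; rewrite -raddfB;
  [exact: abs_Re_le_normc|exact: abs_Im_le_normc].
Qed.

Lemma circle_power_bounded_cmeasurable n :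
  bounded_cmeasurable (fun z : borel_circle R => circle_val z ^+ n).
Proof.
elim: n => [|n IH]; first exact: bounded_cmeasurable_cst.
rewrite (_ : (fun z => _) = fun z => circle_val z * circle_val z ^+ n); last first.
  by apply/funext => z; rewrite exprS.
apply: bounded_cmeasurableM IH.
have [cR cI] := continuous_ReIm.
split; split.
- apply: (@continuous_circle_measurable (fun z => Re z)) => z.
  by apply: continuous_comp; [exact: circle_val_continuous|exact: cR].
- exists 1 => z; rewrite -(circle_normc z); exact: abs_Re_le_normc.
- apply: (@continuous_circle_measurable (fun z => Im z)) => z.
  by apply: continuous_comp; [exact: circle_val_continuous|exact: cI].
- exists 1 => z; rewrite -(circle_normc z); exact: abs_Im_le_normc.
Qed.

End circle_functions.

Section cesaro_means.
Variables (R : realType) (k : nat -> nat).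
Local Open Scope complex_scope.
Local Notation normc := (@Normc.normc R).
Local Notation Re := (@complex.Re R).
Local Notation Im := (@complex.Im R).

Lemma cvgC_normc (u : nat -> R[i]) : u @ \oo --> 0 -> (fun n => normc (u n)) @ \oo --> 0.
Proof.
move=> /cvgrPdist_lt ul; apply/cvgrPdist_lt => e e0.
have e0C : 0 < e%:C :> R[i] by rewrite ltcR.
have := ul _ e0C; apply: filterS => n.
by rewrite Defs.normcE ltcR sub0r normcN sub0r normrN ger0_norm ?normc_ge0.
Qed.

Lemma normc_cesaro_mean (z : circle R) N : normc (cesaro_mean k z N) <= 1.
Proof.
rewrite /cesaro_mean natrVC Normc.normcM normc_real ger0_norm ?invr_ge0//.
have [->|N0] := posnP N; first by rewrite invr0 mul0r.
rewrite ler_pdivrMl ?ltr0n// mulr1 (le_trans (normc_sum _ _ _))//.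
under eq_bigr do rewrite normcX circle_normc expr1n.
by rewrite sumr_const_nat subn1.
Qed.

Lemma circle_divP (w z : circle R) : normc (circle_val w / circle_val z) = 1.
Proof. by rewrite unimodularM ?unimodularV ?circle_normc. Qed.

(** Keeps the quotient in the type [circle], to which [good] and [spectrum] refer. *)
Definition circle_div (w z : circle R) : circle R :=
  projT1 (cid (circle_ex (circle_divP w z))).

Lemma circle_divE (w z : circle R) : circle_val (circle_div w z) = circle_val w / circle_val z.
Proof. exact: projT2 (cid (circle_ex (circle_divP w z))). Qed.

Lemma countable_circle_div (S : set (circle R)) z :
  countable S -> countable [set w | S (circle_div w z)].
Proof.
move=> /countable_injP[f finj]; apply/countable_injP.
exists (fun w => f (circle_div w z)) => v w; rewrite !inE/= => Sv Sw vw.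
have := finj _ _ (mem_set Sv) (mem_set Sw) vw => /(congr1 (@circle_val R)).
rewrite !circle_divE => /(mulIf _) => H; apply: circle_val_inj; apply: H.
by rewrite invr_eq0 unimodular_neq0// circle_normc.
Qed.

(** * Vanishing of the quadratic means for countable spectrum *)

Section wiener.
Variable mu : complex_measure (borel_circle R) R.
Hypothesis mu_cont : continuous_cmeasure mu.

Let c n := fourier_coef mu (Posz (k n)).
Let I := cmeasure_integral mu.

Let cE n : cmeasure_integral mu (fun z => circle_val z ^+ k n) = c n.
Proof. by []. Qed.

Lemma wiener_mean_cvg0 : good R k -> countable (spectrum R k) ->
  (fun N => N%:R^-1 * \sum_(1 <= n < N.+1) normc (fourier_coef mu (Posz (k n))) ^+ 2)
    @ \oo --> 0.
Proof.
move=> kgood kspec.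
pose g N (z : borel_circle R) :=
  \sum_(1 <= n < N.+1) (N%:R^-1 * conjc (c n)) * circle_val z ^+ k n.
pose f (z : borel_circle R) N (w : borel_circle R) :=
  \sum_(1 <= n < N.+1) (N%:R^-1 * (circle_val z)^-1 ^+ k n) * circle_val w ^+ k n.
have bg N : bounded_cmeasurable (g N).
  by apply: bounded_cmeasurable_sum => n; exact: circle_power_bounded_cmeasurable.
have bf z N : bounded_cmeasurable (f z N).
  by apply: bounded_cmeasurable_sum => n; exact: circle_power_bounded_cmeasurable.
have fE z N w : f z N w = cesaro_mean k (circle_div w z) N.
  rewrite /cesaro_mean circle_divE mulr_sumr; apply: eq_bigr => n _.
  by rewrite exprMn; ring.
have f1 z N w : normc (f z N w) <= 1 by rewrite fE normc_cesaro_mean.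
(* Conjugation turns the coefficients into their conjugates and the inverse powers of [z] into
   powers. *)
have gE z N : g N z = conjc (I (f z N)).
  rewrite /I cmeasure_integral_sum; last by move=> n; exact: circle_power_bounded_cmeasurable.
  rewrite rmorph_sum; apply: eq_bigr => n _.
  rewrite cE; move: (c n) => cn; rewrite !rmorphM rmorphXn natrVC.
  rewrite [X in _ = X * _ * _]conjc_real [X in _ = _ * X ^+ _ * _]conjc_inv.
  rewrite [X in _ = _ * (X^-1) ^+ _ * _](unimodular_conjc (circle_normc _)) invrK.
  by rewrite mulrAC.
have mu0 (a : borel_circle R) : measurable [set a] /\ mu [set a] = 0.
  by split; [exact: circle_measurable_set1|exact: mu_cont].
have [K hK] := cmeasure_integral_bound mu.
have gK N z : normc (g N z) <= K * 1.
  by rewrite gE normc_conjc; apply: hK.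
have g0 z : (fun N => normc (g N z)) @ \oo --> 0.
  under eq_fun do rewrite gE normc_conjc.
  (* The exceptional set is the spectrum rotated by [z]; elsewhere the limit of the Cesaro means at
     [w / z] is 0. *)
  apply: (cmeasure_integral_cvg0 mu0 (countable_circle_div z kspec) (bf z) (f1 z)) => w /=.
  rewrite /spectrum/= => /negP; rewrite negbK => /eqP cw0.
  under eq_fun do rewrite fE.
  by apply: cvgC_normc; rewrite -cw0; exact: kgood.
(* Integration pairs each [c n] with its conjugate; the result is a nonnegative real, hence its own
   modulus. *)
have gI N : N%:R^-1 * \sum_(1 <= n < N.+1) normc (c n) ^+ 2 =
    normc (cmeasure_integral mu (g N)).
  rewrite cmeasure_integral_sum; last by move=> n; exact: circle_power_bounded_cmeasurable.
  rewrite (_ : \sum_(1 <= n < N.+1) _ * _ =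
    (N%:R^-1 * \sum_(1 <= n < N.+1) normc (c n) ^+ 2)%:C).
    by rewrite normc_real ger0_norm// mulr_ge0 ?invr_ge0// sumr_ge0// => n _; rewrite sqr_ge0.
  rewrite real_complexM -natrVC -sum_real_complex mulr_sumr; apply: eq_bigr => n _.
  by rewrite cE -mulrA [conjc _ * _]mulrC -normc_sqrC.
rewrite (funext gI).
exact: (cmeasure_integral_cvg0 mu0 (@countable0 _) bg gK (fun x _ => g0 x)).
Qed.

End wiener.
End cesaro_means.

(** * Rigidity sequences *)

Section rigidity.
Variables (R : realType) (k : nat -> nat).
Local Open Scope complex_scope.
Local Notation normc := (@Normc.normc R).
Local Notation Re := (@complex.Re R).
Local Notation Im := (@complex.Im R).

Lemma subsequence_cvg_infty : subsequence k ->
  forall L, exists n1, forall n, (n1 <= n)%N -> (L <= k n)%N.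
Proof.
move=> [_ [n0 kinc]] L; exists (n0 + L)%N.
have H i : (i <= k (n0 + i))%N.
  elim: i => // i IH; rewrite addnS (leq_ltn_trans IH)//.
  by apply: kinc => //; exact: leq_addr.
by move=> n /subnK <-; rewrite addnCA (leq_trans _ (H _))// leq_addl.
Qed.

Lemma cesaro_mean_cvg0 (u : nat -> R) : u @ \oo --> 0 ->
  (fun N => N%:R^-1 * \sum_(1 <= n < N.+1) u n) @ \oo --> 0.
Proof.
move=> u0; rewrite -cvg_shiftS.
have /cesaro : (fun n => u n.+1) @ \oo --> 0 by rewrite (cvg_shiftS u).
apply: cvg_trans; apply: near_eq_cvg; apply: nearW => N /=.
by rewrite big_add1.
Qed.

Lemma Rintegral_sum d (T : measurableType d) (m : {finite_measure set T -> \bar R})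
    (I : Type) (s : seq I) (f : I -> T -> R) :
  (forall i, bounded_measurable (f i)) ->
  \int[m]_x (\sum_(i <- s) f i x) = \sum_(i <- s) \int[m]_x f i x.
Proof.
move=> bf; suff [] : bounded_measurable (fun x => \sum_(i <- s) f i x) /\
  \int[m]_x (\sum_(i <- s) f i x) = \sum_(i <- s) \int[m]_x f i x by [].
elim: s => [|i s [bs IH]].
  under eq_fun do rewrite big_nil; rewrite big_nil Rintegral_cst// mul0r.
  by split=> //; exact: bounded_measurable_cst.
have -> : (fun x => \sum_(i <- i :: s) f i x) = fun x => f i x + \sum_(i <- s) f i x.
  by apply/funext => x; rewrite big_cons.
split; first exact: bounded_measurableD.
by rewrite big_cons RintegralD ?IH//; exact: bounded_measurable_integrable.
Qed.

Lemma cmeasure_integral_of d (T : measurableType d)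
    (m : {finite_measure set T -> \bar R}) (f : T -> R[i]) :
  cmeasure_integral (cmeasure_of m) f =
  (\int[m]_x Re (f x)) +i* (\int[m]_x Im (f x)).
Proof.
have mE A : measurable A -> cmeasure_Re (cmeasure_of m) A = m A.
  by move=> mA; rewrite /cmeasure_Re/= fineK// fin_num_measure.
have m0 A : measurable A -> cmeasure_Im (cmeasure_of m) A = @mzero _ T R A by [].
rewrite /cmeasure_integral !(charge_integral_measure _ mE) !(charge_integral_measure _ m0).
by rewrite /Rintegral !integral_measure_zero subr0 addr0.
Qed.

Definition sqr_dist (theta z : R[i]) (n : nat) : R := normc (z ^+ k n - theta) ^+ 2.

Definition mean_sqr_dist (theta z : R[i]) (N : nat) : R :=
  N%:R^-1 * \sum_(1 <= n < N.+1) sqr_dist theta z n.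

(** For unimodular numbers the squared distance is affine in the real and imaginary parts, so it can
    be integrated through Fourier coefficients and averaged through Cesaro means. *)
Lemma sqr_distE theta z n : normc theta = 1 -> normc z = 1 ->
  sqr_dist theta z n = 2 - 2 * (Re theta * Re (z ^+ k n) + Im theta * Im (z ^+ k n)).
Proof.
move=> t1 z1; rewrite /sqr_dist normc_sqr.
have := normc_sqr (z ^+ k n); rewrite unimodularX// expr1n.
have := normc_sqr theta; rewrite t1 expr1n.
by case: (_ ^+ k n) => a b; case: theta {t1} => c e /= h1 h2; lra.
Qed.

Lemma sqr_dist_bound theta z n : normc theta = 1 -> normc z = 1 ->
  0 <= sqr_dist theta z n <= 4.
Proof.
move=> t1 z1; rewrite sqr_ge0/= /sqr_dist.
have -> : 4 = 2 ^+ 2 :> R by rewrite expr2; lra.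
rewrite lerXn2r ?nnegrE ?normc_ge0//.
by rewrite (le_trans (le_normcD _ _))// normcN t1 unimodularX.
Qed.

Lemma mean_sqr_dist_ge0 theta z N : 0 <= mean_sqr_dist theta z N.
Proof. by rewrite mulr_ge0 ?invr_ge0// sumr_ge0// => n _; exact: sqr_ge0. Qed.

Lemma mean_sqr_dist_le theta z N : normc theta = 1 -> normc z = 1 ->
  mean_sqr_dist theta z N <= 4.
Proof.
move=> t1 z1; rewrite /mean_sqr_dist.
have [->|N0] := posnP N; first by rewrite invr0 mul0r.
rewrite ler_pdivrMl ?ltr0n// (le_trans (ler_sum _ (G := fun=> 4) _))//.
  by move=> n _; have /andP[] := sqr_dist_bound n t1 z1.
by rewrite sumr_const_nat subn1/= mulr_natl.
Qed.

(** At [N = 0] the left side would be 0 and the right side 2, as the inverse of 0 is 0. *)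
Lemma mean_sqr_distE theta (z : circle R) N : normc theta = 1 -> (0 < N)%N ->
  mean_sqr_dist theta z N =
  2 - 2 * (Re theta * Re (cesaro_mean k z N) + Im theta * Im (cesaro_mean k z N)).
Proof.
move=> t1 N0; rewrite /cesaro_mean natrVC Re_realM Im_realM Re_sum Im_sum.
rewrite /mean_sqr_dist (eq_bigr _ (fun n _ => sqr_distE n t1 (circle_normc z))).
rewrite sumrB sumr_const_nat subn1/= -mulr_sumr big_split/= -!mulr_sumr -mulr_natl.
by field; rewrite pnatr_eq0 -lt0n.
Qed.

Lemma mean_sqr_dist_cvg theta (z : circle R) : good R k -> normc theta = 1 ->
  cvgn (mean_sqr_dist theta z).
Proof.
move=> kgood t1; have zc := kgood z.
apply/cvg_ex; exists (2 - 2 * (Re theta * Re (good_limit R k z) +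
  Im theta * Im (good_limit R k z))).
have : (fun N => 2 - 2 * (Re theta * Re (cesaro_mean k z N) +
    Im theta * Im (cesaro_mean k z N))) @ \oo -->
    2 - 2 * (Re theta * Re (good_limit R k z) + Im theta * Im (good_limit R k z)).
  apply: cvgB; first exact: cvg_cst.
  apply: cvgM; first exact: cvg_cst.
  apply: cvgD; apply: cvgM; try exact: cvg_cst.
    exact: cvgC_Re.
  exact: cvgC_Im.
apply: cvg_trans; apply: near_eq_cvg; exists 1 => // N /= N0.
by rewrite mean_sqr_distE.
Qed.

Lemma mean_defectE z N : normc z = 1 -> mean_defect k N z = mean_sqr_dist 1 z N / 2.
Proof.
move=> z1; rewrite /mean_defect /mean_sqr_dist -mulrA; congr (_ * _).
rewrite mulr_suml; apply: eq_bigr => n _.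
by rewrite sqr_distE// ?Normc.normc1//=; field.
Qed.

Lemma normc_power_dist1 w j : normc w = 1 -> normc (w ^+ j - 1) <= j%:R * normc (w - 1).
Proof.
move=> w1; rewrite subrX1 Normc.normcM mulrC ler_wpM2r ?normc_ge0//.
rewrite (le_trans (normc_sum _ _ _))//.
by under eq_bigr do rewrite unimodularX//; rewrite sumr_const card_ord.
Qed.

(* Elements approximating the same theta along k differ by a rotation that is
   asymptotically trivial along k, and so are the powers of that rotation. *)
Lemma mean_defect_le theta z z0 j N : normc theta = 1 -> normc z = 1 -> normc z0 = 1 ->
  mean_defect k N ((z / z0) ^+ j) <=
  j%:R ^+ 2 * (mean_sqr_dist theta z N + mean_sqr_dist theta z0 N).
Proof.
move=> t1 z1 z01; have h1 : normc (z / z0) = 1 by rewrite unimodularM ?unimodularV.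
rewrite mean_defectE ?unimodularX// /mean_sqr_dist -mulrDr -[leLHS]mulrA [leRHS]mulrCA.
apply: ler_wpM2l; first by rewrite invr_ge0.
rewrite -big_split/= mulr_suml mulr_sumr.
apply: ler_sum => n _; rewrite ler_pdivrMr// /sqr_dist exprAC.
have e1 : normc (((z / z0) ^+ k n) ^+ j - 1) <=
    j%:R * (normc (z ^+ k n - theta) + normc (z0 ^+ k n - theta)).
  rewrite (le_trans (normc_power_dist1 _ _)) ?unimodularX// ler_wpM2l//.
  have -> : (z / z0) ^+ k n - 1 =
      ((z ^+ k n - theta) - (z0 ^+ k n - theta)) / z0 ^+ k n.
    rewrite expr_div_n opprB addrA subrK mulrBl divff//.
    by rewrite expf_neq0// unimodular_neq0.
  rewrite Normc.normcM unimodularV ?unimodularX// mulr1.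
  by rewrite (le_trans (le_normcD _ _))// normcN.
set a := normc (z ^+ k n - theta) in e1 *; set b := normc (z0 ^+ k n - theta) in e1 *.
have e2 : normc (((z / z0) ^+ k n) ^+ j - 1) ^+ 2 <= (j%:R * (a + b)) ^+ 2.
  by rewrite lerXn2r ?nnegrE ?mulr_ge0 ?addr_ge0 ?normc_ge0.
apply: le_trans e2 _; rewrite exprMn -[leRHS]mulrA. apply: ler_wpM2l; first exact: sqr_ge0.
(* That is, [(a + b) ^+ 2 <= 2 * (a ^+ 2 + b ^+ 2)]; the 2 is absorbed by the half in
   [mean_defectE]. *)
have := sqr_ge0 (a - b); lra.
Qed.

(** For each [m] these are among the finitely many roots of [X^m - z0^m]. Off this set the quotient
    by [z0] has infinite order. *)
Lemma countable_roots (z0 : circle R) :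
  countable [set z : circle R | exists2 m, (0 < m)%N & (z : R[i]) ^+ m = (z0 : R[i]) ^+ m].
Proof.
rewrite (_ : [set z | _] = \bigcup_m
  [set z : circle R | (0 < m)%N /\ (z : R[i]) ^+ m = (z0 : R[i]) ^+ m]); last first.
  by apply/seteqP; split=> [z [m m0 zm]|z [m _ [m0 zm]]]; exists m.
apply: bigcup_countable => // m _.
have [-> //|m0] := posnP m.
  by apply: (sub_countable _ (@countable0 _)); apply: subset_card_le => z [].
have p0 : 'X^m - (circle_val z0 ^+ m)%:P != 0 :> {poly R[i]}.
  by rewrite -size_poly_eq0 size_XnsubC.
have [r rE] := closed_field_poly_normal ('X^m - (circle_val z0 ^+ m)%:P).
have zr (z : circle R) : (z : R[i]) ^+ m = (z0 : R[i]) ^+ m -> circle_val z \in r.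
  move=> zm; rewrite -root_prod_XsubC -(@rootZ _ _ (lead_coef ('X^m - (circle_val z0 ^+ m)%:P))).
    by rewrite -rE rootE !hornerE zm subrr.
  by rewrite lead_coef_eq0.
apply/countable_injP; exists (fun z => index (circle_val z) r) => z w.
rewrite !inE/= => -[_ /zr zin] [_ /zr win] /(congr1 (nth 0 r)).
by rewrite !nth_index// => /circle_val_inj.
Qed.

Section rigid.
Variables (theta : circle R) (P : probability (borel_circle R) R).
Hypothesis P_cont : continuous_cmeasure (cmeasure_of P).
Hypothesis P_rigid : fourier_coef (cmeasure_of P) (Posz (k n)) @[n --> \oo] --> (theta : R[i]).
Hypothesis kgood : good R k.

Let t1 : normc theta = 1 := circle_normc theta.

Let sqr_dist_measurable n : bounded_measurable
  (fun z : borel_circle R => sqr_dist theta (circle_val z) n).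
Proof.
rewrite (_ : (fun z => _) = fun z => 2 - 2 * (Re theta * Re (circle_val z ^+ k n) +
  Im theta * Im (circle_val z ^+ k n))); last first.
  by apply/funext => z; rewrite sqr_distE// circle_normc.
have [bR bI] := circle_power_bounded_cmeasurable R (k n).
apply: bounded_measurableB; first exact: bounded_measurable_cst.
apply: bounded_measurableM; first exact: bounded_measurable_cst.
by apply: bounded_measurableD; apply: bounded_measurableM => //;
  exact: bounded_measurable_cst.
Qed.

Let mean_sqr_dist_measurable N : measurable_fun setT
  (fun z : borel_circle R => mean_sqr_dist theta (circle_val z) N).
Proof.
apply: measurable_funM => //; apply: measurable_sum => n.
by have [] := sqr_dist_measurable n.
Qed.

(** By [sqr_distE] and rigidity the integral of the squared distance tends to [2 - 2 |theta|^2 = 0],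
    and Cesaro averaging preserves the limit. *)
Lemma integral_mean_sqr_dist_cvg0 :
  (fun N => \int[P]_z mean_sqr_dist theta (circle_val z) N) @ \oo --> 0.
Proof.
have intE n : \int[P]_z sqr_dist theta (circle_val z) n =
    2 - 2 * (Re theta * Re (fourier_coef (cmeasure_of P) (Posz (k n))) +
             Im theta * Im (fourier_coef (cmeasure_of P) (Posz (k n)))).
  have [bR bI] := circle_power_bounded_cmeasurable R (k n).
  have bc (a : R) := bounded_measurable_cst (borel_circle R) a.
  rewrite /fourier_coef cmeasure_integral_of/=.
  under eq_Rintegral do rewrite sqr_distE ?circle_normc//.
  have b1 := bounded_measurableM (bc (Re theta)) bR.
  have b2 := bounded_measurableM (bc (Im theta)) bI.
  have b3 := bounded_measurableD b1 b2.
  have b4 := bounded_measurableM (bc 2) b3.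
  rewrite RintegralB ?RintegralZl ?RintegralD ?RintegralZl//;
    try exact: bounded_measurable_integrable.
  by rewrite Rintegral_cst//= probability_setT mulr1.
rewrite (_ : (fun N => _) = fun N =>
    N%:R^-1 * \sum_(1 <= n < N.+1) \int[P]_z sqr_dist theta (circle_val z) n); last first.
  apply/funext => N; rewrite /mean_sqr_dist RintegralZl ?Rintegral_sum//.
  apply: bounded_measurable_integrable; split.
    by apply: measurable_sum => n; have [] := sqr_dist_measurable n.
  exists (\sum_(1 <= n < N.+1) 4) => z; rewrite (le_trans (ler_norm_sum _ _ _))//.
  apply: ler_sum => n _; have /andP[d0 d4] := sqr_dist_bound n t1 (circle_normc z).
  by rewrite ger0_norm.
apply: cesaro_mean_cvg0; rewrite (funext intE).
rewrite (_ : 0 = 2 - 2 * (Re theta * Re theta + Im theta * Im theta)); last first.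
  by rewrite -!expr2 -normc_sqr t1; ring.
apply: cvgB; first exact: cvg_cst.
apply: cvgM; first exact: cvg_cst.
apply: cvgD; apply: cvgM; try exact: cvg_cst.
  exact: cvgC_Re.
exact: cvgC_Im.
Qed.

(** Goodness gives a pointwise limit [q]; it is nonnegative with integral 0 by bounded convergence,
    hence 0 almost everywhere. Convergence of the integrals alone would give this only along a
    subsequence. *)
Lemma mean_sqr_dist_cvg0_ae :
  {ae P, forall z, mean_sqr_dist theta (circle_val z) @ \oo --> 0}.
Proof.
pose q (z : borel_circle R) := limn (mean_sqr_dist theta (circle_val z)).
have qlim z : mean_sqr_dist theta (circle_val z) @ \oo --> q z.
  exact: mean_sqr_dist_cvg.
have mq : measurable_fun setT q.
  exact: (measurable_fun_cvg mean_sqr_dist_measurable (fun z _ => qlim z)).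
have q0 z : 0 <= q z.
  by apply: limr_ge; [exact: cvgP (qlim z)|apply: nearW => N; exact: mean_sqr_dist_ge0].
have q4 z : q z <= 4.
  apply: limr_le; [exact: cvgP (qlim z)|apply: nearW => N].
  by rewrite mean_sqr_dist_le// circle_normc.
have bq : bounded_measurable q by split => //; exists 4 => z; rewrite ger0_norm.
have intq : \int[P]_z q z = 0.
  have dom N (z : borel_circle R) : `|mean_sqr_dist theta (circle_val z) N| <= 4.
    by rewrite ger0_norm ?mean_sqr_dist_ge0// mean_sqr_dist_le// circle_normc.
  have := Rintegral_bounded_cvg (m := P) mean_sqr_dist_measurable mq dom (aeW P qlim).
  by move=> /(cvg_unique (@Rhausdorff R)) /(_ integral_mean_sqr_dist_cvg0).
have /ae_eq_integral_abs : measurable_fun setT (EFin \o q) by exact/measurable_EFinP.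
move=> /(_ P measurableT)[+ _].
have -> : (\int[P]_z `|(EFin \o q) z| = 0)%E.
  under eq_integral do rewrite gee0_abs ?lee_fin ?q0//.
  rewrite -[LHS]fineK; last first.
    exact: (integrable_fin_num measurableT (bounded_measurable_integrable P bq)).
  by move: intq; rewrite /Rintegral => ->.
move=> /(_ erefl); apply: filterS => z /(_ I) [qz].
by rewrite -qz; exact: qlim.
Qed.

(** Almost every [z0] will do; then [z] must avoid a null set and [countable_roots z0], which is
    null because [P] has no atoms. *)
Lemma exists_infinite_order_pair : exists z0 z : circle R,
  [/\ mean_sqr_dist theta (circle_val z0) @ \oo --> 0,
      mean_sqr_dist theta (circle_val z) @ \oo --> 0 &
      forall m, (0 < m)%N -> ((z : R[i]) / (z0 : R[i])) ^+ m != 1].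
Proof.
have pick (B : set (borel_circle R)) : P.-negligible B -> exists z, ~ B z.
  move=> [A [mA A0 BA]]; apply: contrapT => /forallNP nB.
  have AT : A = setT by apply/seteqP; split=> // z _; apply: BA; exact: contrapT.
  by move: A0; rewrite AT probability_setT => /eqP; rewrite onee_eq0.
have [z0 /contrapT hz0] := pick _ mean_sqr_dist_cvg0_ae.
have P0 (a : borel_circle R) : measurable [set a] /\ P [set a] = 0%E.
  split; first exact: circle_measurable_set1.
  have := P_cont a => /= /complexI Pa.
  by rewrite -(@fineK _ (P [set a])) ?Pa// fin_num_measure//; exact: circle_measurable_set1.
have := @countable_negligible _ (borel_circle R) R P _ (countable_roots z0) P0.
move=> /(negligibleU mean_sqr_dist_cvg0_ae)/pick[z /not_orP[/contrapT hz nroot]].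
exists z0, z; split=> // m m0; apply/eqP => zm; apply: nroot; exists m => //.
have z00 : circle_val z0 ^+ m != 0 by rewrite expf_neq0// unimodular_neq0// circle_normc.
by rewrite -[LHS](divfK z00) -expr_div_n zm mul1r.
Qed.

End rigid.

Lemma rigidity_not_good (theta : circle R) : subsequence k ->
  rigidity_sequence theta k -> ~ good R k.
Proof.
move=> hk [P [P_cont P_rigid]] kgood.
have [z0 [z [hz0 hz hinf]]] := exists_infinite_order_pair P_cont P_rigid kgood.
have t1 := circle_normc theta; have z1 := circle_normc z; have z01 := circle_normc z0.
apply: (@no_convergence_at_infinite_order R k (circle_val z / circle_val z0)) => //.
- by rewrite unimodularM ?unimodularV.
- exact: subsequence_cvg_infty.
(* The defect is half the mean squared distance to 1, so goodness makes it converge at every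
   point. *)
- move=> w w1; have [v vw] := circle_ex w1; rewrite -vw.
  rewrite (funext (fun N => mean_defectE N (circle_normc v))).
  apply: is_cvgMl; apply: mean_sqr_dist_cvg => //; exact: Normc.normc1.
- move=> j; apply: (@cvg0_le R _ (fun N => j%:R ^+ 2 *
    (mean_sqr_dist theta (circle_val z) N + mean_sqr_dist theta (circle_val z0) N))) => [N|].
    rewrite ger0_norm; first exact: mean_defect_le.
    suff /(mean_defect_bound k N)/andP[] : normc ((circle_val z / circle_val z0) ^+ j) = 1 by [].
    by rewrite unimodularX// unimodularM ?unimodularV.
  rewrite (_ : 0 = j%:R ^+ 2 * (0 + 0)); last by rewrite addr0 mulr0.
  by apply: cvgM; [exact: cvg_cst|exact: cvgD].
Qed.

End rigidity.

Theorem proposition3p15 (R : realType) (k : nat -> nat) (hk : subsequence k) :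
  ((exists mu : complex_measure (borel_circle R) R,
      continuous_cmeasure mu /\
      (0 < limn_esup (fun N : nat =>
         (N%:R^-1 * \sum_(1 <= n < N.+1)
            Normc.normc (fourier_coef mu (Posz (k n))) ^+ 2)%:E))%E) ->
    ~ good R k \/ (good R k /\ ~ countable (spectrum R k)))
  /\
  (forall theta : circle R, rigidity_sequence theta k -> ~ good R k).
Proof.
split; last by move=> theta; exact: rigidity_not_good.
move=> [mu [mu_cont mu_pos]]; have [kgood|] := pselect (good R k); last by left.
(* A countable spectrum would make the means tend to 0, so their limsup would be 0. *)
right; split=> // kspec; move: mu_pos.
set u := (fun N => _%:E).
have cv : u @ \oo --> 0%:E.
  apply: cvg_EFin; first exact: nearW.
  exact: wiener_mean_cvg0 mu_cont kgood kspec.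
rewrite is_cvg_limn_esupE; last exact: cvgP cv.
by rewrite (cvg_lim _ cv)// ltxx.
Qed.
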